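(* Every finite-dimensional Banach space over $\mathbb{K}$ has the BPB property.
   Context: $\mathbb{K}$ is $\mathbb{R}$ or $\mathbb{C}$; $S_Y$ and $Y^*$ denote the unit sphere and the dual of $Y$. For a closed subspace $X$ of a Banach space $Y$, $\Pi(X,Y)=\{(x,y^* )\in S_X\times S_{Y^*} : y^*(x)=1\}$. The pair $(X,Y)$ is a BPB-pair if for every $\varepsilon>0$ there exists $\delta>0$ such that whenever $x_0\in S_X$, $y_0^*\in S_{Y^*}$ satisfy $\mathrm{Re}\,y_0^*(x_0)>1-\delta$, there exists $(x,y^* )\in\Pi(X,Y)$ with $\|x_0-x\|<\varepsilon$ and $\|y_0^*-y^*\|<\varepsilon$. $Y$ has the BPB property if $(X,Y)$ is a BPB-pair for every closed subspace $X$ of $Y$. *)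

(* Defs.v *)
From HB Require Import structures.
From mathcomp Require Import all_boot all_order all_algebra.
From mathcomp Require Import complex.
From mathcomp Require Import all_classical all_reals all_analysis.

Set Implicit Arguments.
Unset Strict Implicit.
Unset Printing Implicit Defensive.

Import Order.TTheory GRing.Theory Num.Theory.
Import numFieldNormedType.Exports.

Local Open Scope classical_set_scope.
Local Open Scope ring_scope.

Definition finite_dimensional (K : numFieldType) (Y : lmodType K) : Prop :=
  exists (n : nat) (e : 'I_n -> Y),
    forall y : Y, exists c : 'I_n -> K, y = \sum_(i < n) c i *: e i.

Definition unit_sphere (K : numFieldType) (Y : normedModType K) : set Y :=
  [set y | `|y| = 1].

(* Norms take their values in K itself, so the supremum is the one of the
   (partial) order of K: for K = R[i], z <= w means that w - z is a nonnegative
   real number, hence the upper bounds of a nonempty set of reals are real.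
   The default value 0 is used only when the set is unbounded, that is, never
   for a continuous linear f. *)
Definition dual_norm (K : numFieldType) (Y : normedModType K) (f : Y -> K) : K :=
  supremum 0 [set `|f y| | y in [set y : Y | `|y| <= 1]].

Definition dual_sphere (K : numFieldType) (Y : normedModType K) :
    set {linear Y -> K^o} :=
  [set f : {linear Y -> K^o} | continuous f /\ dual_norm f = 1].

Definition closed_subspace (K : numFieldType) (Y : normedModType K)
    (X : set Y) : Prop :=
  closed X /\ submod_closed [in X].

Definition BPB_Pi (K : numFieldType) (Y : normedModType K) (X : set Y) :
    set (Y * {linear Y -> K^o}) :=
  [set p | [/\ X p.1, unit_sphere p.1, dual_sphere p.2 & p.2 p.1 = 1]].

(* [re] is the real part on K: the identity for real scalars, 'Re for complex
   ones. *)
Definition BPB_pair (K : numFieldType) (re : K -> K) (Y : normedModType K)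
    (X : set Y) : Prop :=
  forall eps : K, 0 < eps ->
  exists2 delta : K, 0 < delta &
    forall (x0 : Y) (f0 : {linear Y -> K^o}),
      X x0 -> unit_sphere x0 -> dual_sphere f0 ->
      1 - delta < re (f0 x0) ->
      exists (x : Y) (f : {linear Y -> K^o}),
        [/\ BPB_Pi X (x, f), `|x0 - x| < eps & dual_norm (f0 \- f) < eps].

Definition BPB_property (K : numFieldType) (re : K -> K)
    (Y : completeNormedModType K) : Prop :=
  forall X : set Y, closed_subspace X -> BPB_pair re X.

(* Main.v *)
From HB Require Import structures.
Require Import Defs.
From mathcomp Require Import all_boot all_order all_algebra.
From mathcomp Require Import complex.
From mathcomp Require Import all_classical all_reals all_analysis.
From mathcomp Require Import ring lra.

Import Num.Theory.
Local Open Scope ring_scope.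

Set Implicit Arguments.
Unset Strict Implicit.
Unset Printing Implicit Defensive.
Import Order.TTheory GRing.Theory.
Import numFieldNormedType.Exports.
Local Open Scope classical_set_scope.

(** The proof is a compactness argument.  If [(X, Y)] is not a BPB-pair, some
    [eps] admits, for every [d > 0], a bad pair [(x_d, f_d)]: a norm-one vector
    [x_d] of [X] and a norm-one functional [f_d] with [re (f_d x_d) > 1 - d],
    such that no point of [Pi(X, Y)] is [eps]-close to it.  Since [Y] and its
    dual are finite dimensional, such pairs have a limit [(x, f)] as [d] tends
    to 0; then [x] lies in [X] because [X] is closed, [x] has norm one, and
    [f x = 1], so [(x, f)] belongs to [Pi(X, Y)] and is [eps]-close to a bad
    pair: a contradiction.

    The limits are taken along an ultrafilter [U] finer than the right
    neighbourhoods of 0 in the scalar field.  Every bounded scalar function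
    converges along [U] ([ultra_bounded_cvg]), so no subsequences have to be
    extracted and the functionals [f_d] converge pointwise at all vectors
    simultaneously ([ultra_contractions_cvg]).  Convergence in norm, of the
    vectors and of the functionals, comes from the bound of the coordinates in
    a basis by the norm ([coordinates_bounded]), which is itself proved by the
    same kind of ultrafilter limit.

    The real and complex cases are treated together, over a scalar field [K]
    about which only two things matter: its closed unit ball is compact, and
    [re] satisfies [`|1 - z| ^+ 2 <= 2 * (1 - re z)] on it.  The inequality says
    that a scalar of the unit ball whose real part is close to 1 is itself close
    to 1, whence [f x = 1]. *)

(** * Limits along ultrafilters *)

Section Ultrafilters.
Variables (T : Type) (U : set_system T).
Hypothesis UU : UltraFilter U.

Lemma ultra_fmap (S : Type) (g : T -> S) : UltraFilter (g @ U).
Proof.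
split; first exact: fmap_proper_filter.
move=> G PG sUG; apply/seteqP; split=> // A GA.
have [//|UcA] := in_ultra_setVsetC (g @^-1` A) UU.
have /(@filter_ex _ _ PG)[s []//] : G (A `&` ~` A).
by apply: filterI => //; exact: sUG.
Qed.

Lemma compact_ultra_cvg (S : topologicalType) (A : set S) (g : T -> S) :
  compact A -> (\forall t \near U, A (g t)) ->
  exists2 x, A x & g @ U --> x.
Proof.
rewrite compact_ultra => cA UA.
by have [x [Ax gx]] := cA _ (ultra_fmap g) UA; exists x.
Qed.

End Ultrafilters.

(** The scalars may be only partially ordered, as in [R[i]], so the bound is
    compared with [`|v|] up to every positive [e] rather than by the closedness
    of order intervals. *)
Lemma norm_cvg_le (K : numFieldType) (V : normedModType K) (T : Type)
    (F : set_system T) (PF : ProperFilter F) (g : T -> V) (v : V) (M : K) :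
  g @ F --> v -> (\forall t \near F, `|g t| <= M) -> `|v| <= M.
Proof.
move=> /cvgrPdist_lt gv gM; apply/ler_addgt0Pl => e e0.
have [t [vt tM]] := filter_ex (filterI (gv _ e0) gM).
rewrite -(subrK (g t) v); apply: le_trans (ler_normD _ _) _.
by apply: lerD => //; exact: ltW.
Qed.

Lemma cvg_sumr (K : numFieldType) (V : normedModType K) (T : Type)
    (F : set_system T) (FF : Filter F) n (g : 'I_n -> T -> V) (v : 'I_n -> V) :
  (forall i, g i @ F --> v i) ->
  \sum_(i < n) g i t @[t --> F] --> \sum_(i < n) v i.
Proof. by move=> gv; apply: cvg_big => //; exact: add_continuous. Qed.

(** * The dual norm *)

Section DualNorm.
Variables (K : numFieldType) (Y : normedModType K).

(** A nonzero dual norm cannot be the default value of [supremum], so it is a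
    genuine least upper bound. *)
Lemma dual_norm_supremums (g : Y -> K) : dual_norm g != 0 ->
  supremums [set `|g y| | y in [set y : Y | `|y| <= 1]] (dual_norm g).
Proof.
rewrite /dual_norm /supremum; case: ifP => _; first by rewrite eqxx.
by case: xgetP => [x -> //|_]; rewrite eqxx.
Qed.

(** When the supremum does not exist, its default value 0 still satisfies the
    bound. *)
Lemma dual_norm_le (g : Y -> K) (C : K) : 0 <= C ->
  (forall y, `|y| <= 1 -> `|g y| <= C) -> dual_norm g <= C.
Proof.
move=> C0 gC; have [->//|/dual_norm_supremums[_]] := eqVneq (dual_norm g) 0.
by apply => _ [y y1 <-]; exact: gC.
Qed.

Lemma dual_sphere_contraction (f : {linear Y -> K^o}) (y : Y) :
  dual_sphere f -> `|f y| <= `|y|.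
Proof.
move=> [_ f1]; have [->|y0] := eqVneq y 0; first by rewrite linear0 !normr0.
have /dual_norm_supremums[+ _] : dual_norm f != 0 by rewrite f1 oner_eq0.
rewrite f1 => /(_ `|f (`|y|^-1 *: y)|) H.
have : `|f (`|y|^-1 *: y)| <= 1.
  apply: H; exists (`|y|^-1 *: y) => //=.
  by rewrite normrZ normfV normr_id mulVf// normr_eq0.
rewrite linearZ [`|_ *: _|]normrM normfV normr_id.
by rewrite mulrC ler_pdivrMr ?mul1r// normr_gt0.
Qed.

(** The bound 1 is attained at [x], so the supremum exists whatever the
    completeness of the scalars. *)
Lemma contraction_dual_sphere (f : {linear Y -> K^o}) (x : Y) :
  (forall y, `|f y| <= `|y|) -> `|x| = 1 -> f x = 1 -> dual_sphere f.
Proof.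
move=> fle x1 fx1.
have ub1 : ubound [set `|f y| | y in [set y : Y | `|y| <= 1]] 1.
  by move=> _ [y /= y1 <-]; exact: le_trans (fle y) y1.
have A1 : [set `|f y| | y in [set y : Y | `|y| <= 1]] 1.
  by exists x => /=; rewrite ?x1// fx1 normr1.
split.
  move=> y; apply/cvgrPdist_lt => e e0; near=> w.
  rewrite -linearB; apply: le_lt_trans (fle _) _.
  by near: w; exact: cvgr_dist_lt.
rewrite /dual_norm /supremum ifF; last first.
  by apply/negP => /eqP A0; rewrite A0 in A1.
case: xgetP => [z -> zA|/(_ 1)[]]; last by split=> // u; apply.
apply: (is_subset1_supremums zA); split=> // u; apply.
Unshelve. all: by end_near. Qed.

End DualNorm.

(** * Finite-dimensional spaces over a locally compact field *)

Section LocallyCompactScalars.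
Variable K : numFieldType.
Hypothesis compact_unit_ball : compact [set z : K^o | `|z| <= 1].

Lemma ultra_bounded_cvg (T : Type) (U : set_system T) (UU : UltraFilter U)
    (g : T -> K^o) (M : K) :
  (\forall t \near U, `|g t| <= M) -> exists z : K^o, g @ U --> z.
Proof.
move=> gM.
have [t0 /(le_trans (normr_ge0 _)) M0] := filter_ex gM.
have M1 : 0 < M + 1 by rewrite ltr_wpDl.
have : \forall t \near U, `|(M + 1)^-1 *: g t| <= 1.
  near=> t.
  rewrite normrZ normfV (gtr0_norm M1) mulrC ler_pdivrMr// mul1r.
  have gtM : `|g t| <= M by near: t.
  by rewrite (le_trans gtM)// lerDl.
move=> /(compact_ultra_cvg UU compact_unit_ball)[z _ gz].
exists ((M + 1) *: z).
have -> : g = fun t => (M + 1) *: ((M + 1)^-1 *: g t).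
  by apply/funext => t; rewrite scalerA divff ?scale1r// gt_eqF.
exact: cvgZl_tmp.
Unshelve. all: by end_near. Qed.

Variable Y : normedModType K.

(** A spanning family of minimal size is free: a nontrivial relation expresses
    one of its vectors through the others, which then span alone. *)
Lemma finite_dimensional_basis : finite_dimensional Y ->
  exists (n : nat) (e : 'I_n -> Y),
    (forall y : Y, exists c : 'I_n -> K, y = \sum_(i < n) c i *: e i) /\
    (forall c : 'I_n -> K, \sum_(i < n) c i *: e i = 0 -> forall i, c i = 0).
Proof.
move=> fY.
have ex : exists n, `[< exists e : 'I_n -> Y,
    forall y : Y, exists c : 'I_n -> K, y = \sum_(i < n) c i *: e i >].
  by have [n en] := fY; exists n; apply/asboolP.
have [n /asboolP[e span_e] min_n] := ex_minnP ex.
exists n, e; split=> // c c0 j; apply/eqP/negPn/negP => cj.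
case: n => [|n] in e span_e min_n c c0 j cj *; first by case: j cj.
suff /asboolP/min_n : exists e : 'I_n -> Y,
    forall y : Y, exists c : 'I_n -> K, y = \sum_(i < n) c i *: e i.
  by rewrite ltnn.
exists (e \o lift j) => y; have [d ->] := span_e y.
(* Subtracting d j / c j times the relation c cancels the j-th coordinate. *)
exists (fun i => d (lift j i) - d j / c j * c (lift j i)).
transitivity (\sum_i (d i - d j / c j * c i) *: e i).
  under [RHS]eq_bigr do rewrite scalerBl -scalerA.
  by rewrite sumrB -scaler_sumr c0 scaler0 subr0.
rewrite (bigD1_ord j)//= divfK// subrr scale0r add0r.
by apply: eq_bigr.
Qed.

Variables (n : nat) (e : 'I_n -> Y).
Hypothesis free_e :
  forall c : 'I_n -> K, \sum_(i < n) c i *: e i = 0 -> forall i, c i = 0.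

(** Otherwise there would be coordinate vectors of l1-norm 1 giving combinations
    of norm less than [d], for every [d > 0]; a limit as [d] tends to 0 is a
    nontrivial relation between the [e i]. *)
Lemma coordinates_bounded :
  exists2 M : K, 0 < M &
    forall c : 'I_n -> K, \sum_(i < n) `|c i| <= M * `|\sum_(i < n) c i *: e i|.
Proof.
apply: contrapT => unbounded.
have bad d : exists c : 'I_n -> K, 0 < d ->
    \sum_(i < n) `|c i| = 1 /\ `|\sum_(i < n) c i *: e i| < d.
  have [d0|] := boolP (0 < d); last by exists (fun=> 0).
  have [c /negP] : exists c : 'I_n -> K,
      ~ \sum_(i < n) `|c i| <= d^-1 * `|\sum_(i < n) c i *: e i|.
    apply/existsNP => bnd; apply: unbounded.
    by exists d^-1 => //; rewrite invr_gt0.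
  have rs : \sum_(i < n) `|c i| \is Num.real.
    by rewrite ger0_real// sumr_ge0.
  rewrite -real_ltNge//; last by rewrite realM// ?realV gtr0_real.
  rewrite mulrC ltr_pdivrMr// => lt_c.
  set s := \sum_(i < n) `|c i| in rs lt_c *.
  have s0 : 0 < s.
    by rewrite -(pmulr_lgt0 _ d0); apply: le_lt_trans lt_c.
  exists (fun i => s^-1 * c i) => _; split.
    under eq_bigr do rewrite normrM normfV (gtr0_norm s0).
    by rewrite -mulr_sumr mulVf// gt_eqF.
  under eq_bigr do rewrite -scalerA.
  rewrite -scaler_sumr normrZ normfV (gtr0_norm s0) mulrC.
  by rewrite ltr_pdivrMr// mulrC.
have [c cP] := choice bad.
have [U [UU sU]] := ultraFilterLemma (at_right_proper_filter (0 : K)).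
have U0 : \forall d \near U, 0 < d by apply: sU; exact: nbhs_right_gt.
have /choice[l cl] : forall i, exists l : K^o, (c^~ i : K -> K^o) @ U --> l.
  move=> i; apply: (@ultra_bounded_cvg _ U UU _ 1).
  near=> d; have d0 : 0 < d by near: d.
  have [<- _] := cP _ d0.
  by rewrite (bigD1 i)//= lerDl sumr_ge0.
have sum_l : \sum_(i < n) l i *: e i = 0.
  have : \sum_(i < n) c d i *: e i @[d --> U] --> \sum_(i < n) l i *: e i.
    by apply: cvg_sumr => i; apply: cvgZr_tmp; exact: cl.
  move/cvg_unique; apply; first exact: norm_hausdorff.
  apply/cvgrPdist_lt => r r0; near=> d.
  rewrite sub0r normrN; have d0 : 0 < d by near: d.
  apply: lt_trans (cP _ d0).2 _.
  by near: d; apply: sU; exact: nbhs_right_lt.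
have norm_l : \sum_(i < n) `|l i| = 1.
  have : \sum_(i < n) (`|c d i| : K^o) @[d --> U] -->
      \sum_(i < n) (`|l i| : K^o).
    by apply: cvg_sumr => i; apply: cvg_norm; exact: cl.
  move/cvg_unique; apply; first exact: norm_hausdorff.
  apply/cvgrPdist_lt => r r0; near=> d.
  have d0 : 0 < d by near: d.
  by rewrite (cP _ d0).1 subrr normr0.
move: norm_l; rewrite big1 => [/esym/eqP|i _]; first by rewrite oner_eq0.
by rewrite (free_e sum_l) normr0.
Unshelve. all: by end_near. Qed.

Hypothesis span_e :
  forall y : Y, exists c : 'I_n -> K, y = \sum_(i < n) c i *: e i.

Lemma ultra_cvg_finite_dimensional
    (T : Type) (U : set_system T) (UU : UltraFilter U) (x : T -> Y) (M : K) :
  (\forall t \near U, `|x t| <= M) -> exists l : Y, x @ U --> l.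
Proof.
move=> xM; have [B B0 cB] := coordinates_bounded.
have [c cE] := choice (fun t => span_e (x t)).
have /choice[l cl] : forall i, exists l : K^o, (c^~ i : T -> K^o) @ U --> l.
  move=> i; apply: (@ultra_bounded_cvg _ U UU _ (B * M)); near=> t.
  apply: (@le_trans _ _ (B * `|x t|)).
    rewrite [in leRHS]cE; apply: le_trans (cB _).
    by rewrite (bigD1 i)//= lerDl sumr_ge0.
  by rewrite ler_pM2l//; near: t.
exists (\sum_(i < n) l i *: e i).
rewrite (_ : x = fun t => \sum_(i < n) c t i *: e i); last exact/funext.
by apply: cvg_sumr => i; apply: cvgZr_tmp; exact: cl.
Unshelve. all: by end_near. Qed.

(** In finite dimension, functionals that converge pointwise converge in dual
    norm: only their values on a basis matter. *)
Lemma dual_norm_finite_dimensional :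
  exists2 M : K, 0 < M & forall f g : {linear Y -> K^o},
    dual_norm (f \- g) <= M * \sum_(i < n) `|f (e i) - g (e i)|.
Proof.
have [M M0 cM] := coordinates_bounded; exists M => // f g.
apply: dual_norm_le => [|y y1]; first by rewrite mulr_ge0 ?sumr_ge0 ?ltW.
have [c yE] := span_e y.
have fE (h : {linear Y -> K^o}) : h y = \sum_(i < n) c i * h (e i) :> K.
  by rewrite yE linear_sum; apply: eq_bigr => i _; rewrite linearZ.
have -> : (f \- g) y = \sum_(i < n) c i * (f (e i) - g (e i)).
  rewrite [LHS]/= !fE -sumrB.
  by apply: eq_bigr => i _; rewrite mulrBr.
have ci i : `|c i| <= M.
  apply: (@le_trans _ _ (\sum_(i < n) `|c i|)).
    by rewrite (bigD1 i)//= lerDl sumr_ge0.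
  by rewrite (le_trans (cM c))// -yE ger_pMr.
apply: le_trans (ler_norm_sum _ _ _) _; rewrite mulr_sumr.
by apply: ler_sum => i _; rewrite normrM ler_wpM2r.
Qed.

End LocallyCompactScalars.

(** * Pointwise limits of contractive functionals *)

Section PointwiseLimit.
Variables (K : numFieldType) (Y : normedModType K).
Hypothesis compact_unit_ball : compact [set z : K^o | `|z| <= 1].

Lemma ultra_contractions_cvg (T : Type) (U : set_system T) (UU : UltraFilter U)
    (F : T -> {linear Y -> K^o}) :
  (\forall t \near U, forall y, `|F t y| <= `|y|) ->
  exists2 f : {linear Y -> K^o},
    forall y, F t y @[t --> U] --> f y & forall y, `|f y| <= `|y|.
Proof.
move=> F1.
have /choice[f Ff] : forall y, exists l : K^o, F t y @[t --> U] --> l.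
  move=> y; apply: (ultra_bounded_cvg compact_unit_ball UU (M := `|y|)).
  by apply: filterS F1 => t; apply.
have f_linear : linear f.
  move=> a u v; apply: (cvg_unique (@norm_hausdorff _ K^o) (Ff (a *: u + v))).
  have : a *: F t u + F t v @[t --> U] --> a *: f u + f v.
    by apply: cvgD (Ff v); apply: cvgZl_tmp.
  by under eq_cvg do rewrite -linearP.
pose fL : {linear Y -> K^o} :=
  HB.pack f (GRing.isLinear.Build K Y K^o *:%R f f_linear).
exists fL => // y; apply: norm_cvg_le (Ff y) _.
by apply: filterS F1 => t; apply.
Qed.

End PointwiseLimit.

(** * The BPB property *)

Lemma BPB_finite_dimensional (K : numFieldType) (re : K -> K)
    (Y : completeNormedModType K) :
  compact [set z : K^o | `|z| <= 1] ->
  (forall z : K, `|z| <= 1 -> `|1 - z| ^+ 2 <= 2 * (1 - re z)) ->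
  finite_dimensional Y -> BPB_property re Y.
Proof.
move=> cK reP /finite_dimensional_basis[n [e [span_e free_e]]].
move=> X [clX _] eps eps0; apply: contrapT => noBPB.
(* A pair showing that d does not serve as a delta for eps. *)
pose bad (d : K) (p : Y * {linear Y -> K^o}) := [/\ X p.1, unit_sphere p.1,
  dual_sphere p.2, 1 - d < re (p.2 p.1) &
  ~ exists (x : Y) (f : {linear Y -> K^o}),
     [/\ BPB_Pi X (x, f), `|p.1 - x| < eps & dual_norm (p.2 \- f) < eps]].
have badP d : exists p, 0 < d -> bad d p.
  have [d0|_] := boolP (0 < d); last by exists (0, \0 : {linear Y -> K^o}).
  apply: contrapT => good; apply: noBPB; exists d => // x0 f0 Xx0 x01 f01 df0.
  by apply: contrapT => none; apply: good; exists (x0, f0).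
have {badP}[p badp] := choice badP.
have [U [UU sU]] := ultraFilterLemma (at_right_proper_filter (0 : K)).
have small d : 0 < d -> \forall t \near U, t < d.
  by move=> d0; apply: sU; exact: nbhs_right_lt.
have {}badp : \forall t \near U, bad t (p t).
  by apply: filterS (sU _ (nbhs_right_gt 0)) => t; exact: badp.
have p1 : \forall t \near U, `|(p t).1| = 1.
  by apply: filterS badp => t [].
have [|x px] := ultra_cvg_finite_dimensional cK free_e span_e UU
    (x := fun t => (p t).1) (M := 1).
  by apply: filterS p1 => t ->.
have p2 : \forall t \near U, forall y, `|(p t).2 y| <= `|y|.
  by apply: filterS badp => t [_ _ pt _ _] y; exact: dual_sphere_contraction.
have [f pf f1] := ultra_contractions_cvg cK UU p2.
have x1 : `|x| = 1.
  apply: (cvg_unique (@norm_hausdorff _ K^o) (cvg_norm px)).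
  apply/cvgrPdist_lt => r r0.
  by apply: filterS p1 => t ->; rewrite subrr normr0.
have fx1 : f x = 1.
  apply: (cvg_unique (@norm_hausdorff _ K^o) (pf x)).
  apply/cvgrPdist_lt => r r0.
  have r20 : 0 < r / 2 by rewrite divr_gt0.
  have r2sq0 : 0 < 2^-1 * (r / 2) ^+ 2.
    by rewrite mulr_gt0 ?invr_gt0 ?exprn_gt0.
  near=> t; have [_ x1t _ ret _] : bad t (p t) by near: t.
  have p2t : forall y, `|(p t).2 y| <= `|y| by near: t.
  (* Go from 1 to (p t).2 x through (p t).2 (p t).1: the first step is small
     by reP, the second because (p t).2 is a contraction and (p t).1 --> x. *)
  rewrite -(subrK ((p t).2 (p t).1) 1) -addrA -linearB (splitr r).
  apply: le_lt_trans (ler_normD _ _) _; apply: ltrD; last first.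
    apply: le_lt_trans (p2t _) _; rewrite distrC.
    by near: t; exact: cvgr_dist_lt.
  rewrite -(@ltr_pXn2r _ 2)// ?nnegrE ?(ltW r20)//.
  apply: le_lt_trans (reP _ _) _; first by rewrite -x1t; exact: p2t.
  rewrite -ltr_pdivlMl// ltrBlDl -ltrBlDr; apply: le_lt_trans ret.
  rewrite lerD2l lerN2 ltW//; near: t; exact: (small _ r2sq0).
have Xx : X x.
  by apply: (closed_cvg X clX _ _ px); apply: filterS badp => t [].
have [M M0 dM] := dual_norm_finite_dimensional cK free_e span_e.
have close_f : \forall t \near U, dual_norm ((p t).2 \- f) < eps.
  have : \sum_(i < n) (`|(p t).2 (e i) - f (e i)| : K^o) @[t --> U] -->
      \sum_(i < n) (0 : K^o).
    apply: cvg_sumr => i; rewrite -(@normr0 _ K^o); apply: cvg_norm.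
    by rewrite -(subrr (f (e i))); apply: cvgB; [exact: pf|exact: cvg_cst].
  rewrite big1// => /cvgrPdist_lt/(_ (M^-1 * eps)).
  rewrite mulr_gt0 ?invr_gt0// => /(_ isT); apply: filterS => t.
  rewrite sub0r normrN ger0_norm ?sumr_ge0// ltr_pdivlMl//.
  exact: le_lt_trans.
have close_x : \forall t \near U, `|(p t).1 - x| < eps.
  by move/cvgrPdist_lt: px => /(_ _ eps0); apply: filterS => t; rewrite distrC.
have [t [[[_ _ _ _ none] xt] ft]] :=
  filter_ex (filterI (filterI badp close_x) close_f).
apply: none; exists x, f; split=> //; split=> //=.
exact: contraction_dual_sphere x1 fx1.
Unshelve. all: by end_near. Qed.

(** * Real and complex scalars *)

Lemma compact_unit_ball_real (R : realType) : compact [set x : R^o | `|x| <= 1].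
Proof.
rewrite (_ : [set x | _] = `[-1, 1]%classic); first exact: segment_compact.
by apply/seteqP; split=> x /=; rewrite in_itv/= ler_norml.
Qed.

Lemma norm_complex_le (R : rcfType) (z : R[i]) :
  `|z| <= (`|complex.Re z| + `|complex.Im z|)%:C%C.
Proof.
rewrite normc_def lecR -(@ler_pXn2r _ 2)// ?nnegrE ?sqrtr_ge0 ?addr_ge0//.
rewrite sqr_sqrtr ?addr_ge0 ?sqr_ge0// sqrrD !real_normK ?num_real//.
by rewrite addrAC lerDl mulrn_wge0 ?mulr_ge0.
Qed.

Lemma norm_Im_le (R : rcfType) (z : R[i]) : `|complex.Im z|%:C%C <= `|z|.
Proof.
rewrite normc_def lecR -(@ler_pXn2r _ 2)// ?nnegrE ?sqrtr_ge0//.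
by rewrite sqr_sqrtr ?addr_ge0 ?sqr_ge0// real_normK ?num_real// lerDr sqr_ge0.
Qed.

(** The real and imaginary parts converge along an ultrafilter of the ball by
    compactness of the real unit ball, and they control the modulus. *)
Lemma compact_unit_ball_complex (R : realType) :
  compact [set z : (R[i])^o | `|z| <= 1].
Proof.
rewrite compact_ultra => F UF F1.
have Re_le (z : R[i]) : `|z| <= 1 -> `|complex.Re z| <= 1.
  by move=> z1; rewrite -lecR (le_trans (normc_ge_Re z)).
have Im_le (z : R[i]) : `|z| <= 1 -> `|complex.Im z| <= 1.
  by move=> z1; rewrite -lecR (le_trans (norm_Im_le z)).
have [a _ Fa] := compact_ultra_cvg UF (@compact_unit_ball_real R)
  (filterS (fun z => @Re_le z) F1).
have [b _ Fb] := compact_ultra_cvg UF (@compact_unit_ball_real R)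
  (filterS (fun z => @Im_le z) F1).
have Fab : id @ F --> (Complex a b : (R[i])^o).
  apply/cvgrPdist_lt => e e0.
  have [r r0 ->] : exists2 r : R, 0 < r & e = (r%:C)%C.
    case: e e0 => r s; rewrite ltcE/= => /andP[/eqP -> r0].
    by exists r.
  have r20 : 0 < r / 2 by rewrite divr_gt0.
  move/cvgrPdist_lt: Fa => /(_ _ r20) Fa.
  move/cvgrPdist_lt: Fb => /(_ _ r20) Fb.
  near=> z; apply: le_lt_trans (norm_complex_le _) _.
  rewrite ltcR (splitr r); apply: ltrD.
    rewrite (_ : complex.Re _ = a - complex.Re z); last by case: (z).
    by near: z; exact: Fa.
  rewrite (_ : complex.Im _ = b - complex.Im z); last by case: (z).
  by near: z; exact: Fb.
exists (Complex a b); split=> //=.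
exact: norm_cvg_le Fab F1.
Unshelve. all: by end_near. Qed.

(** Because [`|1 - z| ^+ 2 = 1 - 2 * 'Re z + `|z| ^+ 2]. *)
Lemma sqr_dist1_le_re (C : numClosedFieldType) (z : C) : `|z| <= 1 ->
  `|1 - z| ^+ 2 <= 2 * (1 - 'Re z).
Proof.
move=> z1; have : `|z| ^+ 2 <= 1 by rewrite expr_le1.
rewrite !normCK rmorphB rmorph1.
have -> : 2 * (1 - 'Re z) = 2 - (z + z^*).
  by rewrite mulrBr mulr1 ReE mulrC divfK// pnatr_eq0.
move=> zz.
have -> : (1 - z) * (1 - z^*) = z * z^* + (1 - (z + z^*)) by ring.
by rewrite -(lerD2r (1 - (z + z^*))) in zz; rewrite (le_trans zz)// addrA.
Qed.

Theorem corollary4p8 (R : realType) :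
  (forall Y : completeNormedModType R,
     finite_dimensional Y -> BPB_property (fun t : R => t) Y) /\
  (forall Y : completeNormedModType R[i],
     finite_dimensional Y -> BPB_property (fun z : R[i] => 'Re z) Y).
Proof.
split=> Y; apply: BPB_finite_dimensional.
- exact: compact_unit_ball_real.
- move=> z; rewrite ler_norml => z1; rewrite real_normK ?num_real//; nra.
- exact: compact_unit_ball_complex.
- exact: sqr_dist1_le_re.
Qed.
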